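(* Let $X$ and $Y$ be cellular spaces with $X$ compact, and let $r\ge 0$ be an integer. Let $a,b,\tilde a,\tilde b\in Y^X$ be maps such that $\tilde a\sim a$, $a\overset{r}{\sim}b$, and $b\sim\tilde b$. Then $\tilde a\overset{r}{\sim}\tilde b$.
   Context: All spaces are based topological spaces with basepoint denoted $*$. A cellular space is a CW-complex whose basepoint is a vertex. A subspace of a space is a subset containing the basepoint. Maps are based continuous maps; $Y^X$ is the set of maps $X\to Y$; $\sim$ denotes based homotopy of maps. For a set $E$, $\langle E\rangle$ is the free abelian group with basis elements $\langle e\rangle$, $e\in E$. Elements of $\langle Y^X\rangle$ are called ensembles; an ensemble is a finite sum $A=\sum_i u_i\langle a_i\rangle$ with $u_i\in\mathbb Z$, $a_i\in Y^X$ (the $a_i$ need not be distinct). For a subspace $Z\subseteq X$, restriction of maps induces a homomorphism $\langle Y^X\rangle\to\langle Y^Z\rangle$, $A\mapsto A|_Z$. $\mathcal F_r(X)$ is the set of subspaces $T\subseteq X$ containing at most $r$ points distinct from the basepoint. For $A,B\in\langle Y^X\rangle$, $A\overset{r}{=}B$ means that $A|_T=B|_T$ in $\langle Y^T\rangle$ for all $T\in\mathcal F_r(X)$. For $a,b\in Y^X$, $a$ is $r$-similar to $b$, written $a\overset{r}{\sim}b$, if there is an ensemble $A=\sum_i u_i\langle a_i\rangle\in\langle Y^X\rangle$ with all $a_i\sim a$ such that $A\overset{r}{=}\langle b\rangle$. *)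

(* Defs.v *)
From HB Require Import structures.
From mathcomp Require Import all_boot all_order all_algebra.
From mathcomp Require Import freeg.
From mathcomp Require Import mathcomp_extra boolp classical_sets functions.
From mathcomp Require Import cardinality set_interval reals.
From mathcomp Require Import topology normedtype.

Set Implicit Arguments.
Unset Strict Implicit.
Unset Printing Implicit Defensive.

Import Order.TTheory GRing.Theory Num.Theory.
Import numFieldNormedType.Exports.

Local Open Scope classical_set_scope.
Local Open Scope ring_scope.

Section CellularSpaces.
Variable R : realType.

Definition disk (n : nat) : set 'rV[R]_n :=
  [set v | \sum_(i < n) v 0 i ^+ 2 <= 1].
Definition open_disk (n : nat) : set 'rV[R]_n :=
  [set v | \sum_(i < n) v 0 i ^+ 2 < 1].
Definition sphere (n : nat) : set 'rV[R]_n :=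
  [set v | \sum_(i < n) v 0 i ^+ 2 = 1].

Arguments disk : clear implicits.
Arguments open_disk : clear implicits.
Arguments sphere : clear implicits.

Section CWComplex.
Variables (X : topologicalType) (I : nat -> Type).

(* I n indexes the n-cells, and chi e is the characteristic map of e. It is a
   total function on R^n, but only its values on the closed disk matter. *)
Variable chi : forall n, I n -> 'rV[R]_n -> X.

Definition open_cell (e : {n & I n}) : set X :=
  chi (projT2 e) @` open_disk (projT1 e).

Definition closed_cell (e : {n & I n}) : set X :=
  chi (projT2 e) @` disk (projT1 e).

Record cw_structure : Prop := {
  cw_hausdorff : hausdorff_space X;
  chi_continuous : forall n (e : I n), {within disk n, continuous (chi e)};
  chi_injective : forall n (e : I n), set_inj (open_disk n) (chi e);
  (* With the two previous fields: chi e restricts to a homeomorphism from the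
     open disk onto the open cell. *)
  chi_open : forall n (e : I n) (U : set 'rV[R]_n), open U ->
    exists2 V : set X, open V &
      chi e @` (U `&` open_disk n) = V `&` chi e @` open_disk n;
  open_cells_disjoint : forall e e' : {n & I n},
    open_cell e `&` open_cell e' !=set0 -> e = e';
  open_cells_cover : forall x : X, exists e, open_cell e x;
  closure_finite : forall n (e : I n),
    exists F : set {k & I k},
      [/\ finite_set F, forall c, F c -> (projT1 c < n)%N &
          chi e @` sphere n `<=` \bigcup_(c in F) open_cell c];
  weak_topology : forall A : set X,
    (forall e, closed (A `&` closed_cell e)) -> closed A }.

End CWComplex.

(* X is a CW-complex, for some cell structure in which x0 is a vertex. *)
Definition cellular (X : topologicalType) (x0 : X) : Prop :=
  exists (I : nat -> Type) (chi : forall n, I n -> 'rV[R]_n -> X),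
    cw_structure chi /\ exists v : I 0, open_cell chi (existT I 0 v) x0.

End CellularSpaces.

Record based_map (X Y : topologicalType) (x0 : X) (y0 : Y) := BasedMap {
  map_fun :> X -> Y;
  map_continuous : continuous map_fun;
  map_base : map_fun x0 = y0 }.

HB.instance Definition _ (X Y : topologicalType) (x0 : X) (y0 : Y) :=
  gen_eqMixin (based_map x0 y0).
HB.instance Definition _ (X Y : topologicalType) (x0 : X) (y0 : Y) :=
  gen_choiceMixin (based_map x0 y0).

Definition homotopic (R : realType) (X Y : topologicalType) (x0 : X) (y0 : Y)
    (f g : based_map x0 y0) : Prop :=
  exists H : R * X -> Y,
    [/\ {within `[0, 1] `*` [set: X], continuous H},
        forall x, H (0, x) = f x,
        forall x, H (1, x) = g x &
        forall t, 0 <= t <= 1 -> H (t, x0) = y0].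

Notation ensemble x0 y0 := {freeg (based_map x0 y0) / int}.

Section Restriction.
Variables (X Y : topologicalType) (x0 : X) (y0 : Y).

Definition sub_base (T : set X) (Tx0 : T x0) : set_type T :=
  exist _ x0 (mem_set Tx0).

Lemma map_restr_continuous (T : set X) (f : based_map x0 y0) :
  continuous (fun x : set_type T => f (set_val x)).
Proof.
move=> x; apply: continuous_comp; last exact: map_continuous.
exact: (@initial_continuous (set_type T) X set_val).
Qed.

Definition map_restr (T : set X) (Tx0 : T x0) (f : based_map x0 y0) :
    based_map (sub_base Tx0) y0 :=
  @BasedMap _ _ (sub_base Tx0) y0 (fun x => f (set_val x))
    (@map_restr_continuous T f) (map_base f).

Definition ens_restr (T : set X) (Tx0 : T x0) :
    ensemble x0 y0 -> ensemble (sub_base Tx0) y0 :=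
  fglift (fun f => << map_restr Tx0 f >>).

End Restriction.

Definition small_subspaces (X : topologicalType) (x0 : X) (r : nat) :
    set (set X) :=
  [set T | T x0 /\ (T `\ x0 #<= `I_r)%card].

Definition req (X Y : topologicalType) (x0 : X) (y0 : Y) (r : nat)
    (A B : ensemble x0 y0) : Prop :=
  forall T (hT : small_subspaces x0 r T),
    ens_restr (proj1 hT) A = ens_restr (proj1 hT) B.

Definition rsimilar (R : realType) (X Y : topologicalType) (x0 : X) (y0 : Y)
    (r : nat) (a b : based_map x0 y0) : Prop :=
  exists (n : nat) (u : 'I_n -> int) (c : 'I_n -> based_map x0 y0),
    (forall i, homotopic R (c i) a) /\
    req r (\sum_(i < n) << u i *g c i >>) << b >>.

(* Main.v *)
(** Let Psi : X x Y -> Y be such that Psi(x, y) is joined to y by a path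
    depending continuously on (x, y) in the relevant range, and
    Psi(x, b x) = tb x. Replacing each map c of an ensemble by x |-> Psi(x, c x)
    keeps it in its homotopy class, and the restriction of the new map to T
    depends only on the restriction of c to T. Hence an ensemble that is
    r-equal to <b> becomes one that is r-equal to <tb>.

    All maps in play except the homotopy h from b to tb take values in a finite
    subcomplex K of Y. Given a path from y to z in K, continuous in (y, z) near
    the diagonal, Psi(x, y) is obtained for y near b x by going from y to b x
    and then along h, stopping earlier and earlier as y moves away from b x.

    Such paths exist by induction on the cells of K. If K arises from K' by
    attaching a cell, let p and q be the images of y and z under the map that
    pushes the outer shell of the cell into K', after sliding y linearly to z
    when both are well inside the cell; then p = q unless both lie in K'. The
    path from p to q in K' need not be constant when p = q, so it must be undone
    over the inner part of the cell: p and q are both moved along the paths that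
    K' provides from p to q and from q to q, cut off by a function of the
    radius, and these two motions end at the same point. *)
Require Import Defs.
From HB Require Import structures.
From mathcomp Require Import all_boot all_order all_algebra.
From mathcomp Require Import freeg ring lra.
From mathcomp Require Import mathcomp_extra boolp classical_sets functions.
From mathcomp Require Import cardinality set_interval reals topology normedtype.
From mathcomp Require Import realfun.
Set Implicit Arguments.
Unset Strict Implicit.
Unset Printing Implicit Defensive.

Import Order.TTheory GRing.Theory Num.Theory.
Import numFieldNormedType.Exports.

Local Open Scope classical_set_scope.
Local Open Scope ring_scope.

(** * Continuity on subsets *)

Section Within.
Context {T U V : topologicalType}.
Implicit Types (A B : set T) (C : set U).

Lemma within_comp A C (f : T -> U) (g : U -> V) :
  {within C, continuous g} -> {within A, continuous f} ->
  (forall x, A x -> C (f x)) -> {within A, continuous (fun x => g (f x))}.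
Proof.
move=> /subspace_continuousP cg /subspace_continuousP cf AC.
apply/subspace_continuousP => x Ax.
move=> W gW; have CW := cf x Ax _ (cg _ (AC _ Ax) W gW).
have {}CW : nbhs x [set z | A z -> C (f z) -> W (g (f z))] by [].
suff : nbhs x [set z | A z -> W (g (f z))] by [].
by apply: filterS CW => z /= h Az; exact: (h Az (AC _ Az)).
Qed.

Lemma within_compT A (f : T -> U) (g : U -> V) :
  continuous g -> {within A, continuous f} ->
  {within A, continuous (fun x => g (f x))}.
Proof.
move=> cg cf; apply: (@within_comp _ setT) => //.
exact: continuous_subspaceT.
Qed.

Lemma within_pair A (f : T -> U) (g : T -> V) :
  {within A, continuous f} -> {within A, continuous g} ->
  {within A, continuous (fun x => (f x, g x))}.
Proof. by move=> cf cg x; apply: cvg_pair; [exact: cf|exact: cg]. Qed.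

Lemma within_sub A B (f : T -> U) : A `<=` B ->
  {within B, continuous f} -> {within A, continuous f}.
Proof. exact: continuous_subspaceW. Qed.

Lemma within_ext A (f g : T -> U) : (forall x, A x -> f x = g x) ->
  {within A, continuous f} -> {within A, continuous g}.
Proof.
by move=> fg; apply: subspace_eq_continuous => x /set_mem; exact: fg.
Qed.

Lemma within_closed A C (f : T -> U) : closed A -> {within A, continuous f} ->
  closed C -> closed (A `&` f @^-1` C).
Proof.
move=> clA /continuous_closedP cf /cf /closed_subspaceP[D clD DA].
by rewrite setIC -DA; exact: closedI.
Qed.

Lemma within_glue A B (f g h : T -> U) : closed A -> closed B ->
  {within A, continuous f} -> {within B, continuous g} ->
  (forall x, A x -> h x = f x) -> (forall x, B x -> h x = g x) ->
  {within A `|` B, continuous h}.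
Proof.
move=> clA clB cf cg hf hg; apply: withinU_continuous => //.
  by apply: within_ext cf => x /hf.
by apply: within_ext cg => x /hg.
Qed.

(* pi restricts to a closed map, hence to a quotient map, from a compact set *)
Lemma within_quotient A (pi : T -> U) (f : U -> V) :
  hausdorff_space U -> compact A -> {within A, continuous pi} ->
  {within A, continuous (fun x => f (pi x))} ->
  {within pi @` A, continuous f}.
Proof.
move=> hU kA cpi cf; apply/continuous_closedP => W clW.
have /continuous_closedP/(_ _ clW)/closed_subspaceP[D clD DA] := cf.
apply/closed_subspaceP; exists (pi @` (D `&` A)).
  apply: compact_closed => //; apply: continuous_compact.
    by apply: within_sub cpi => x [].
  by rewrite setIC; exact: compact_closedI.
rewrite DA; apply/seteqP; split => x.
  by case=> -[t [Wt At] <-] _; split => //; exists t.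
case=> Wx [t At tx]; split; exists t => //.
by split => //; move: Wx; rewrite -tx.
Qed.

(** Lets the quotient argument [within_quotient] run on cylinders. *)
Lemma hausdorff_prod :
  hausdorff_space T -> hausdorff_space U -> hausdorff_space (T * U)%type.
Proof.
move=> hT hU p q pq; rewrite [p]surjective_pairing [q]surjective_pairing.
congr pair.
  apply: hT => A B pA qB.
  have [z [Az Bz]] := pq (fst @^-1` A) (fst @^-1` B) (cvg_fst pA) (cvg_fst qB).
  by exists z.1.
apply: hU => A B pA qB.
have [z [Az Bz]] := pq (snd @^-1` A) (snd @^-1` B) (cvg_snd pA) (cvg_snd qB).
by exists z.2.
Qed.

End Within.

(** * Real- and vector-valued functions: arithmetic, pasting along a level, cut-offs *)

Section WithinReal.
Context {R : realType} {T : topologicalType}.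
Implicit Types (A : set T) (f g : T -> R).

Lemma within_add A f g : {within A, continuous f} -> {within A, continuous g} ->
  {within A, continuous (fun x => f x + g x)}.
Proof. by move=> cf cg x; apply: (@cvgD _ R^o); [exact: cf|exact: cg]. Qed.

Lemma within_opp A f : {within A, continuous f} ->
  {within A, continuous (fun x => - f x)}.
Proof. by move=> cf x; apply: (@cvgN _ R^o); exact: cf. Qed.

Lemma within_mul A f g : {within A, continuous f} -> {within A, continuous g} ->
  {within A, continuous (fun x => f x * g x)}.
Proof. by move=> cf cg x; apply: cvgM; [exact: cf|exact: cg]. Qed.

Lemma within_cst A (c : R) : {within A, continuous (fun=> c)}.
Proof. by move=> x; exact: cvg_cst. Qed.

Lemma within_max A f g : {within A, continuous f} -> {within A, continuous g} ->
  {within A, continuous (fun x => Num.max (f x) (g x))}.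
Proof. by move=> cf cg x; apply: continuous_max; [exact: cf|exact: cg]. Qed.

Lemma within_min A f g : {within A, continuous f} -> {within A, continuous g} ->
  {within A, continuous (fun x => Num.min (f x) (g x))}.
Proof. by move=> cf cg x; apply: continuous_min; [exact: cf|exact: cg]. Qed.

Lemma within_scale n A f (v : T -> 'rV[R]_n) :
  {within A, continuous f} -> {within A, continuous v} ->
  {within A, continuous (fun x => f x *: v x)}.
Proof. by move=> cf cg x; apply: cvgZ; [exact: cf|exact: cg]. Qed.

Lemma within_addv n A (u v : T -> 'rV[R]_n) :
  {within A, continuous u} -> {within A, continuous v} ->
  {within A, continuous (fun x => u x + v x)}.
Proof. by move=> cf cg x; apply: cvgD; [exact: cf|exact: cg]. Qed.

(** Pasting over two closed pieces that overlap exactly in the level set [om x = r], where the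
    branches agree. *)
Lemma within_if_le (U : topologicalType) A (om : T -> R) (r : R)
    (f g : T -> U) :
  closed A -> {within A, continuous om} ->
  {within A `&` [set x | om x <= r], continuous f} ->
  {within A `&` [set x | r <= om x], continuous g} ->
  (forall x, A x -> om x = r -> f x = g x) ->
  {within A, continuous (fun x => if om x <= r then f x else g x)}.
Proof.
move=> clA com cf cg fg.
have -> : A = (A `&` [set x | om x <= r]) `|` (A `&` [set x | r <= om x]).
  apply/seteqP; split=> x; last by case=> -[].
  by move=> Ax; have [xr|/ltW xr] := leP (om x) r; [left|right].
apply: (within_glue _ _ cf cg).
- exact: (within_closed clA com (@closed_le R r)).
- exact: (within_closed clA com (@closed_ge R r)).
- by move=> x [_ /= ->].
- move=> x [Ax /= xr]; case: ifPn => // rx; apply: fg => //.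
  by apply/eqP; rewrite eq_le xr rx.
Qed.

Lemma within_if_ge (U : topologicalType) A (om : T -> R) (r : R)
    (f g : T -> U) :
  closed A -> {within A, continuous om} ->
  {within A `&` [set x | r <= om x], continuous f} ->
  {within A `&` [set x | om x <= r], continuous g} ->
  (forall x, A x -> om x = r -> f x = g x) ->
  {within A, continuous (fun x => if r <= om x then f x else g x)}.
Proof.
move=> clA com cf cg fg; apply: within_ext (within_if_le clA com cg cf _).
  by move=> x Ax; case: ltgtP => // xr; rewrite fg.
by move=> x Ax xr; rewrite fg.
Qed.

(** The retraction of the line onto [0, 1]; applied to affine functions it yields the cut-offs used
    below. *)
Definition clamp (x : R) : R := Num.max 0 (Num.min 1 x).

Lemma within_clamp A f : {within A, continuous f} ->
  {within A, continuous (fun x => clamp (f x))}.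
Proof.
by move=> cf; apply: within_max; [|apply: within_min => //]; exact: within_cst.
Qed.

Lemma clamp01 x : 0 <= clamp x <= 1.
Proof. by rewrite /clamp le_max lexx /= ge_max ler01 ge_min lexx. Qed.

Lemma mul_clamp01 t x : 0 <= t <= 1 -> 0 <= t * clamp x <= 1.
Proof. by move=> t1; have := clamp01 x; nra. Qed.

Lemma clamp_ge1 x : 1 <= x -> clamp x = 1.
Proof. by move=> x1; rewrite /clamp min_l // max_r. Qed.

Lemma clamp_le0 x : x <= 0 -> clamp x = 0.
Proof. by move=> x0; rewrite /clamp min_r ?max_l // (le_trans x0). Qed.

End WithinReal.

(** * Homotopies of maps on a subset *)

Section RelativeHomotopy.
Context {R : realType} {Z Y : topologicalType}.
Implicit Types (D B : set Z) (K : set Y) (f g h : Z -> Y).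

(** [H] is total, but only its values on [0, 1] x [D] count. [K] confines the motion, and points of
    [D] in [B] are sent to [y0] at all times. *)
Definition homotopic_on D K B (y0 : Y) f g := exists H : R * Z -> Y,
  [/\ {within `[0, 1] `*` D, continuous H},
      forall z, D z -> H (0, z) = f z,
      forall z, D z -> H (1, z) = g z,
      forall (t : R) z, 0 <= t <= 1 -> D z -> K (H (t, z)) &
      forall (t : R) z, 0 <= t <= 1 -> D z -> B z -> H (t, z) = y0].

Lemma cylinderE D : `[0, 1] `*` D = [set p : R * Z | 0 <= p.1 <= 1 /\ D p.2].
Proof. by apply/seteqP; split=> -[t z] /=; rewrite in_itv /=. Qed.

Lemma cylinder_closed D : closed D -> closed (`[0, 1] `*` D : set (R * Z)).
Proof.
move=> clD.
have -> : `[0, 1] `*` D = fst @^-1` `[0, 1 : R]%classic `&` snd @^-1` D by [].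
apply: closedI; apply: closed_comp => //.
- by move=> x _; exact: cvg_fst.
- exact: interval_closed.
- by move=> x _; exact: cvg_snd.
Qed.

Lemma homotopic_on_sym D K B (y0 : Y) f g :
  homotopic_on D K B y0 f g -> homotopic_on D K B y0 g f.
Proof.
case=> H [cH H0 H1 HK HB]; exists (fun p => H (1 - p.1, p.2)); split.
- apply: (within_comp cH) => [|p]; last first.
    by rewrite !cylinderE /= => -[p1 Dp]; split => //; lra.
  apply: within_pair.
    apply: within_add; first exact: within_cst.
    apply: within_opp.  apply: continuous_subspaceT => x; exact: cvg_fst.
  by apply: continuous_subspaceT => x; exact: cvg_snd.
- by move=> z Dz; rewrite /= subr0 H1.
- by move=> z Dz; rewrite /= subrr H0.
- by move=> t z t1 Dz; apply: HK => //=; lra.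
- by move=> t z t1 Dz Bz; apply: HB => //=; lra.
Qed.

(** [D] being closed makes both halves of the cylinder closed, so that pasting at time 1/2
    applies. *)
Lemma homotopic_on_trans D K B (y0 : Y) f g h : closed D ->
  homotopic_on D K B y0 f g -> homotopic_on D K B y0 g h ->
  homotopic_on D K B y0 f h.
Proof.
move=> clD [H [cH H0 H1 HK HB]] [H' [cH' H'0 H'1 H'K H'B]].
exists (fun p => if p.1 <= 1/2 then H (2 * p.1, p.2)
                 else H' (2 * p.1 - 1, p.2)); split.
- have c1 A : {within A, continuous (fun p : R * Z => 2 * p.1)}.
    apply: within_mul; first exact: within_cst.
    by apply: continuous_subspaceT => x; exact: cvg_fst.
  have c2 A : {within A, continuous (@snd R Z)}.
    by apply: continuous_subspaceT => x; exact: cvg_snd.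
  apply: within_if_le.
  + exact: cylinder_closed.
  + by apply: continuous_subspaceT => x; exact: cvg_fst.
  + apply: (within_comp cH) => [|[t z]]; first exact: within_pair.
    by rewrite cylinderE /= => -[[t1 Dz] t2]; split => //; lra.
  + apply: (within_comp cH') => [|[t z]].
      by apply: within_pair => //; apply: within_add => //; exact: within_cst.
    by rewrite cylinderE /= => -[[t1 Dz] t2]; split => //; lra.
  + move=> [t z] [_ Dz] /= ->; rewrite (_ : 2 * (1/2) = 1); last lra.
    by rewrite subrr H1 // H'0.
- by move=> z Dz; rewrite /= ifT ?mulr0 ?H0 //; lra.
- move=> z Dz; rewrite /= ifF; last by apply/negP; lra.
  by rewrite (_ : 2 * 1 - 1 = 1) ?H'1 //; lra.
- by move=> t z t1 Dz /=; case: ifPn => t2; [apply: HK|apply: H'K] => //; lra.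
- move=> t z t1 Dz Bz /=.
  by case: ifPn => t2; [apply: HB|apply: H'B] => //; lra.
Qed.

Lemma homotopic_on_eq D K B (y0 : Y) f g f' g' :
  (forall z, D z -> f z = f' z) -> (forall z, D z -> g z = g' z) ->
  homotopic_on D K B y0 f g -> homotopic_on D K B y0 f' g'.
Proof.
move=> ff gg [H [cH H0 H1 HK HB]]; exists H; split => // z Dz.
  by rewrite H0 // ff.
by rewrite H1 // gg.
Qed.

End RelativeHomotopy.

Lemma homotopic_on_comp (R : realType) (Z Z' Y : topologicalType) (D B : set Z)
    (D' B' : set Z') (K : set Y) y0 (f g : Z -> Y) (k : Z' -> Z) :
  {within D', continuous k} -> (forall z, D' z -> D (k z)) ->
  (forall z, D' z -> B' z -> B (k z)) ->
  homotopic_on (R := R) D K B y0 f g ->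
  homotopic_on (R := R) D' K B' y0 (fun z => f (k z)) (fun z => g (k z)).
Proof.
move=> ck DD BB [H [cH H0 H1 HK HB]]; exists (fun p => H (p.1, k p.2)); split.
- apply: (within_comp cH) => [|p]; last first.
    by rewrite !cylinderE /= => -[p1 /DD].
  apply: within_pair; first by apply: continuous_subspaceT => x; exact: cvg_fst.
  apply: (within_comp ck) => [|p]; last by rewrite cylinderE => -[].
  by apply: continuous_subspaceT => x; exact: cvg_snd.
- by move=> z /DD; exact: H0.
- by move=> z /DD; exact: H1.
- by move=> t z t1 /DD; exact: HK.
- by move=> t z t1 Dz Bz; apply: HB; [|exact: DD|exact: BB].
Qed.

Definition near_diag {R : realType} {Y : topologicalType} (K : set Y)
    (w : Y * Y -> R) :=
  [set x | [/\ K x.1, K x.2 & 1/2 <= w x]].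

(* A weak form of local equiconnectivity: the connecting paths need not be
   constant on the diagonal, except at the base point. *)
Definition equiconnected (R : realType) {Y : topologicalType} (y0 : Y)
    (K : set Y) :=
  exists w : Y * Y -> R, [/\ {within K `*` K, continuous w},
    forall z, K z -> w (z, z) = 1 &
    homotopic_on (R := R) (near_diag K w) K [set (y0, y0)] y0 fst snd].

(** * Attaching a cell *)

Section Radial.
Context {R : realType} (n : nat).
Implicit Types (u v : 'rV[R]_n).

Definition sqnorm v : R := \sum_(i < n) v 0 i ^+ 2.

Lemma sqnorm_ge0 v : 0 <= sqnorm v.
Proof. by apply: sumr_ge0 => i _; exact: sqr_ge0. Qed.

Lemma sqnorm0 : sqnorm 0 = 0.
Proof. by rewrite /sqnorm big1 // => i _; rewrite mxE expr0n. Qed.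

Lemma sqnormZ (c : R) v : sqnorm (c *: v) = c ^+ 2 * sqnorm v.
Proof.
by rewrite /sqnorm mulr_sumr; apply: eq_bigr => i _; rewrite mxE exprMn.
Qed.

Lemma sqnorm_lerp (c r : R) u v : 0 <= c <= 1 -> sqnorm u <= r ->
  sqnorm v <= r -> sqnorm ((1 - c) *: u + c *: v) <= r.
Proof.
move=> c1 ur vr; apply: (@le_trans _ _ ((1 - c) * sqnorm u + c * sqnorm v)).
  rewrite /sqnorm !mulr_sumr -big_split; apply: ler_sum => i _ /=.
  rewrite !mxE -subr_ge0.
  (* The convexity defect of the square is a nonnegative multiple of a square. *)
  rewrite [leRHS](_ : _ = c * (1 - c) * (u 0 i - v 0 i) ^+ 2); last by ring.
  by apply: mulr_ge0 (sqr_ge0 _); apply: mulr_ge0; lra.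
by nra.
Qed.

Lemma sqnorm_continuous : continuous sqnorm.
Proof.
apply: continuous_big => [|i _ v]; first exact: add_continuous.
apply: (@cvg_comp _ _ _ (fun u : 'rV[R]_n => u 0 i) (fun x : R => x ^+ 2)).
  exact: coord_continuous.
exact: exprn_continuous.
Qed.

Lemma sqnorm_le_compact (r : R) : compact [set v | sqnorm v <= r].
Proof.
apply: bounded_closed_compact.
  (* A bound [M] above [1 + r] exceeds both 1 and [r], so its square exceeds [r] and hence the
     square of every coordinate. *)
  exists (1 + r); split; first exact: num_real.
  move=> M rM v /= vr.
  have M0 : 0 <= M by have := sqnorm_ge0 v; lra.
  rewrite [leLHS]/Num.Def.normr /= mx_normrE.
  apply/bigmax_leP; split => //= -[i j] _.
  rewrite /= ord1.
  have : v 0 j ^+ 2 <= sqnorm v.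
    by rewrite /sqnorm (bigD1 j) //= lerDl sumr_ge0 // => k _; exact: sqr_ge0.
  rewrite ler_norml; have := sqnorm_ge0 v; nra.
rewrite (_ : mkset _ = sqnorm @^-1` [set x | x <= r]) //.
apply: closed_comp; last exact: closed_le.
by move=> x _; exact: sqnorm_continuous.
Qed.

(* Pushes the shell outside radius 1/2 onto the unit sphere as t runs from
   0 to 1. *)
Definition radial_push (p : R * 'rV[R]_n) : 'rV[R]_n :=
  (Num.max (Num.sqrt (sqnorm p.2)) (1 + p.1)^-1)^-1 *: p.2.

(** The divisor is at least the Euclidean norm of [v]. *)
Lemma radial_push_sqnorm t v : 0 <= t <= 1 -> sqnorm (radial_push (t, v)) <= 1.
Proof.
move=> t1; rewrite /radial_push sqnormZ /=; set m := Num.max _ _.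
have t0 : 0 < (1 + t)^-1 by rewrite invr_gt0; lra.
have m0 : 0 < m by rewrite lt_max t0 orbT.
have : sqnorm v <= m ^+ 2.
  rewrite -[sqnorm v]sqr_sqrtr ?sqnorm_ge0 // ler_sqr ?nnegrE ?sqrtr_ge0 //.
    by rewrite le_max lexx.
  exact: ltW.
by rewrite exprVn mulrC ler_pdivrMr ?mul1r // exprn_gt0.
Qed.

Lemma radial_push_sphere t v : 0 <= t <= 1 -> sqnorm v = 1 ->
  radial_push (t, v) = v.
Proof.
move=> t1 v1; rewrite /radial_push /= v1 sqrtr1 max_l ?invr1 ?scale1r //.
by rewrite invf_le1; lra.
Qed.

Lemma radial_push_start v : sqnorm v <= 1 -> radial_push (0, v) = v.
Proof.
move=> v1; rewrite /radial_push /= addr0 invr1 max_r ?invr1 ?scale1r //.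
by rewrite -sqrtr1 ler_wsqrtr.
Qed.

(** 1/4 is the square of the radius 1/2: at time 1 the divisor is the norm of [v] as soon as this
    norm is at least 1/2. *)
Lemma radial_push_end v : 1/4 <= sqnorm v -> sqnorm (radial_push (1, v)) = 1.
Proof.
move=> v1; rewrite /radial_push /= max_l ?sqnormZ; last first.
  rewrite (_ : (1 + 1)^-1 = Num.sqrt (1/4)) ?ler_wsqrtr //.
  rewrite (_ : 1/4 = (1/2) ^+ 2); last by field.
  by rewrite sqrtr_sqr ger0_norm; [field|lra].
rewrite exprVn sqr_sqrtr ?mulVf //; lra.
Qed.

Lemma radial_push0 t : radial_push (t, 0) = 0.
Proof. by rewrite /radial_push scaler0. Qed.

(** The term [(1 + t)^-1] keeps the divisor positive, even at [v = 0]. *)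
Lemma radial_push_continuous :
  {within `[0, 1] `*` setT, continuous radial_push}.
Proof.
have cQ A : {within A, continuous (fun p : R * 'rV[R]_n => sqnorm p.2)}.
  apply: (within_compT sqnorm_continuous).
  by apply: continuous_subspaceT => x; exact: cvg_snd.
apply: within_scale; last first.
  by apply: continuous_subspaceT => x; exact: cvg_snd.
have inv_cont : {within [set x : R | 0 < x], continuous (fun x : R => x^-1)}.
  apply: continuous_in_subspaceT => x /set_mem /= x0.
  by apply: inv_continuous; rewrite gt_eqF.
apply: (within_comp inv_cont) => [|[t v]]; last first.
  rewrite cylinderE /= => -[t1 _].
  by rewrite lt_max invr_gt0 orbC; apply/orP; left; lra.
have csq : continuous (Num.sqrt : R -> R) := @sqrt_continuous R.
apply: within_max; first exact: (within_compT csq).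
apply: (within_comp inv_cont) => [|[t v]]; last first.
  by rewrite cylinderE /= => -[t1 _]; lra.
apply: within_add; first exact: within_cst.
by apply: continuous_subspaceT => x; exact: cvg_fst.
Qed.

End Radial.

(** * Equiconnectedness of K', and of K obtained from it by attaching one cell *)

Section AttachCell.
Context {R : realType} {Y : topologicalType} (y0 : Y) (n : nat).
Variables (chi : 'rV[R]_n -> Y) (K' : set Y).
Hypotheses (hausY : hausdorff_space Y) (compK' : compact K').
Hypothesis chi_cont : {within disk (n := n), continuous chi}.
Hypothesis chi_inj : set_inj (open_disk (n := n)) chi.
Hypothesis chi_bd : forall v, sqnorm v = 1 -> K' (chi v).
Hypothesis chi_int : forall v, sqnorm v < 1 -> ~ K' (chi v).

Let cell := chi @` [set v | sqnorm v < 1].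
Let K := K' `|` chi @` disk (n := n).

Let cell_inv (y : Y) : 'rV[R]_n := xget 0 [set v | sqnorm v < 1 /\ chi v = y].
(** The squared radial coordinate of the cell, extended by 1; the thresholds on it below are thus
    squared radii. *)
Let radius (y : Y) : R := if `[< cell y >] then sqnorm (cell_inv y) else 1.

Let cell_invK v : sqnorm v < 1 -> cell_inv (chi v) = v.
Proof.
move=> v1; rewrite /cell_inv; case: xgetP => [u _ [u1 uv]|/(_ v)]; last first.
  by case.
by apply: (chi_inj _ _ uv); rewrite inE.
Qed.

(** Boundary points are excluded because [chi] sends them into [K'], which the image of the interior
    avoids. *)
Let cellE v : sqnorm v <= 1 -> `[< cell (chi v) >] = (sqnorm v < 1).
Proof.
move=> v1; apply/asboolP/idP => [[u u1 uv]|v2]; last by exists v.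
rewrite lt_neqAle v1 andbT; apply/eqP => /chi_bd; rewrite -uv.
exact: chi_int.
Qed.

Let radius_chi v : sqnorm v <= 1 -> radius (chi v) = sqnorm v.
Proof.
move=> v1; rewrite /radius cellE //; case: ifPn => [/cell_invK ->//|].
by rewrite -leNgt; lra.
Qed.

Let not_cell y : K' y -> `[< cell y >] = false.
Proof. by move=> Ky; apply/asboolP => -[v /chi_int /[swap] ->]. Qed.

Let radius_K' y : K' y -> radius y = 1.
Proof. by move=> Ky; rewrite /radius not_cell. Qed.

Let cellP y : K y -> radius y < 1 ->
  chi (cell_inv y) = y /\ sqnorm (cell_inv y) = radius y.
Proof.
case=> [/radius_K' ->|[v v1 <-]]; first by rewrite ltxx.
by rewrite radius_chi // => v2; rewrite cell_invK.
Qed.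

Let compact_disk : compact (disk (R := R) (n := n)).
Proof. exact: sqnorm_le_compact. Qed.

Let compact_image : compact (chi @` disk (n := n)).
Proof. exact: continuous_compact. Qed.

Lemma attach_compact : compact K.
Proof. exact: compactU. Qed.

Let closedK : closed K. Proof. exact: compact_closed attach_compact. Qed.
Let closedK' : closed K'. Proof. exact: compact_closed. Qed.

(** Constant on [K']; on the image of the disk, [chi] is a quotient map and pulls [radius] back to
    [sqnorm]. *)
Let radius_cont : {within K, continuous radius}.
Proof.
apply: withinU_continuous => //; first exact: compact_closed.
  apply: (within_ext (f := fun=> 1 : R)) => [y /radius_K'//|].
  exact: within_cst.
apply: within_quotient => //.
apply: (within_ext (f := @sqnorm R n)) => [v /radius_chi//|].
exact/continuous_subspaceT/sqnorm_continuous.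
Qed.

(** On a smaller closed ball [chi] is injective and a quotient map onto its image, and it pulls its
    inverse back to the identity. *)
Let cell_inv_cont (r : R) : r < 1 ->
  {within [set y | K y /\ radius y <= r], continuous cell_inv}.
Proof.
move=> r1; apply: (within_sub (B := chi @` [set v | sqnorm v <= r])).
  move=> y [Ky yr]; have [yE vE] := cellP Ky (le_lt_trans yr r1).
  by exists (cell_inv y) => //=; rewrite vE.
apply: within_quotient => //; first exact: sqnorm_le_compact.
  by apply: within_sub chi_cont => v /= vr; exact: le_trans (ltW r1).
apply: (within_ext (f := id)) => [v /= vr|]; last first.
  by apply: continuous_subspaceT => x; exact: cvg_id.
by rewrite cell_invK // (le_lt_trans vr).
Qed.

(* Deforms K inside itself, ending with the shell of the cell in K'. *)
Let push (p : R * Y) : Y :=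
  if `[< cell p.2 >] then chi (radial_push (p.1, cell_inv p.2)) else p.2.

Let push_chi t v : 0 <= t <= 1 -> sqnorm v <= 1 ->
  push (t, chi v) = chi (radial_push (t, v)).
Proof.
move=> t1 v1; rewrite /push /= cellE //; case: ifPn => [/cell_invK ->//|].
by rewrite -leNgt => v2; rewrite radial_push_sphere //; lra.
Qed.

Let push_K' t y : K' y -> push (t, y) = y.
Proof. by move=> Ky; rewrite /push not_cell. Qed.

Let push0 y : K y -> push (0, y) = y.
Proof.
case=> [/push_K' ->//|[v v1 <-]].
by rewrite push_chi ?lexx ?ler01 // radial_push_start.
Qed.

Let push_K t y : 0 <= t <= 1 -> K y -> K (push (t, y)).
Proof.
move=> t1 [Ky|[v v1 <-]]; first by rewrite push_K' //; left.
rewrite push_chi //; right; exists (radial_push (t, v)) => //.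
exact: radial_push_sqnorm.
Qed.

Let push1_K' y : K y -> 1/4 <= radius y -> K' (push (1, y)).
Proof.
case=> [Ky|[v v1 <-]]; first by rewrite push_K'.
rewrite radius_chi // push_chi ?lexx ?ler01 // => v2.
by apply: chi_bd; exact: radial_push_end.
Qed.

(** The cylinder over [K] is the union of the one over [K'] and a quotient of the compact cylinder
    over the disk, on which [push] pulls back to [chi] after [radial_push]. *)
Let push_cont : {within `[0, 1] `*` K, continuous push}.
Proof.
have -> : `[0, 1] `*` K = (`[0, 1] `*` K') `|`
    ((fun p : R * 'rV[R]_n => (p.1, chi p.2)) @` (`[0, 1] `*` disk (n := n)))
    :> set (R * Y).
  apply/seteqP; split=> -[t y].
    case=> /= t1 [Ky|[v v1 <-]]; first by left.
    by right; exists (t, v).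
  case=> [[t1 Ky]|[[s v] [s1 v1] [<- <-]]]; split => //; first by left.
  by right; exists v.
have chic : {within `[0, 1] `*` disk (n := n), continuous
    (fun p : R * 'rV[R]_n => (p.1, chi p.2))}.
  apply: within_pair; first by apply: continuous_subspaceT => x; exact: cvg_fst.
  apply: (within_comp chi_cont) => [|p []//].
  by apply: continuous_subspaceT => x; exact: cvg_snd.
have kc : compact ((`[0, 1] : set R) `*` disk (R := R) (n := n)).
  exact: (compact_setX (@segment_compact R 0 1) compact_disk).
have hRY : hausdorff_space (R * Y)%type.
  by apply: hausdorff_prod => //; exact: Rhausdorff.
apply: withinU_continuous.
- exact: cylinder_closed.
- by apply: compact_closed => //; exact: continuous_compact.
- apply: (within_ext (f := snd)) => [[t y] [_ /push_K' ->]//|].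
  by apply: continuous_subspaceT => x; exact: cvg_snd.
apply: within_quotient => //.
apply: (within_ext (f := fun p => chi (radial_push p))).
  by move=> [t v]; rewrite cylinderE /= => -[t1 v1]; rewrite push_chi.
apply: (within_comp chi_cont) => [|[t v]]; last first.
  by rewrite cylinderE /= => -[t1 v1]; exact: radial_push_sqnorm.
by apply: within_sub (@radial_push_continuous _ _) => p [].
Qed.

(* Moves y to z linearly inside the cell when both are well inside, and
   leaves y where it is when one of them is close to the boundary. *)
Let maxrad (x : Y * Y) : R := Num.max (radius x.1) (radius x.2).
Let slide (p : R * (Y * Y)) : Y :=
  if maxrad p.2 <= 4/5 then
    let c := p.1 * clamp (8 - 10 * maxrad p.2) in
    chi ((1 - c) *: cell_inv p.2.1 + c *: cell_inv p.2.2)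
  else p.2.1.

Let slide_inside y z : K y -> K z -> maxrad (y, z) <= 4/5 ->
  [/\ chi (cell_inv y) = y, chi (cell_inv z) = z,
      sqnorm (cell_inv y) <= 4/5 & sqnorm (cell_inv z) <= 4/5].
Proof.
move=> Ky Kz; rewrite /maxrad ge_max => /andP[/= yr zr].
have [| -> ->] := cellP Ky; first lra.
by have [| -> ->] := cellP Kz; first lra.
Qed.

Let slide_K t y z : 0 <= t <= 1 -> K y -> K z -> K (slide (t, (y, z))).
Proof.
move=> t1 Ky Kz; rewrite /slide.
case: ifPn => //= /(slide_inside Ky Kz)[_ _ yr zr].
right; exists ((1 - t * clamp (8 - 10 * maxrad (y, z))) *: cell_inv y +
  (t * clamp (8 - 10 * maxrad (y, z))) *: cell_inv z) => //.
by apply: sqnorm_lerp; [exact: mul_clamp01|lra|lra].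
Qed.

Let slide0 y z : K y -> K z -> slide (0, (y, z)) = y.
Proof.
move=> Ky Kz; rewrite /slide; case: ifPn => //= /(slide_inside Ky Kz)[yE _ _ _].
by rewrite mul0r subr0 scale1r scale0r addr0.
Qed.

(** The coefficient [8 - 10 * maxrad] reaches 1 at 7/10; it vanishes at 4/5, where the two branches
    of [slide] meet. *)
Let slide1 y z : K y -> K z -> maxrad (y, z) <= 7/10 -> slide (1, (y, z)) = z.
Proof.
move=> Ky Kz yz; have yz' : maxrad (y, z) <= 4/5 by lra.
have [_ zE _ _] := slide_inside Ky Kz yz'; rewrite /slide /= yz'.
by rewrite mul1r clamp_ge1 ?subrr ?scale0r ?add0r ?scale1r //; lra.
Qed.

Let slide_diag t y : K y -> slide (t, (y, y)) = y.
Proof.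
move=> Ky; rewrite /slide; case: ifPn => //= /(slide_inside Ky Ky)[yE _ _ _].
by rewrite -scalerDl subrK scale1r.
Qed.

Let maxrad_cont : {within K `*` K, continuous maxrad}.
Proof.
apply: within_max; apply: (within_comp radius_cont) => [|p []//].
  by apply: continuous_subspaceT => x; exact: cvg_fst.
by apply: continuous_subspaceT => x; exact: cvg_snd.
Qed.

Let closedKK : closed (K `*` K).
Proof.
have -> : K `*` K = fst @^-1` K `&` snd @^-1` K by [].
apply: closedI; apply: closed_comp => // x _; first exact: cvg_fst.
exact: cvg_snd.
Qed.

Let slide_cont : {within `[0, 1] `*` (K `*` K), continuous slide}.
Proof.
have csnd A : {within A, continuous (@snd R (Y * Y))}.
  by apply: continuous_subspaceT => x; exact: cvg_snd.
have cmax A : A `<=` `[0, 1] `*` (K `*` K) ->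
    {within A, continuous (fun p : R * (Y * Y) => maxrad p.2)}.
  by move=> AK; apply: (within_comp maxrad_cont) => // p /AK[].
pose L := `[0, 1] `*` (K `*` K) `&` [set p : R * (Y * Y) | maxrad p.2 <= 4/5].
have cL : {within L, continuous (fun p : R * (Y * Y) =>
    p.1 * clamp (8 - 10 * maxrad p.2))}.
  apply: within_mul; first by apply: continuous_subspaceT => x; exact: cvg_fst.
  apply: within_clamp; apply: within_add; first exact: within_cst.
  apply: within_opp; apply: within_mul; first exact: within_cst.
  by apply: cmax => p [].
have r1 : 4/5 < 1 :> R by lra.
have cinv i : continuous i -> (forall y z, i (y, z) = y \/ i (y, z) = z) ->
    {within L, continuous (fun p : R * (Y * Y) => cell_inv (i p.2))}.
  move=> ci iE; apply: (within_comp (cell_inv_cont r1)) => [|[t [y z]]].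
    exact: (within_compT _ (csnd _)).
  case=> -[_ [Ky Kz]] /=; rewrite /maxrad ge_max => /andP[/= yr zr].
  by have [->|->] := iE y z.
apply: within_if_le.
- exact: cylinder_closed.
- exact: cmax.
- apply: (within_comp chi_cont) => [|[t [y z]]]; last first.
    rewrite cylinderE => -[[/= t1 [Ky Kz]] /= /(slide_inside Ky Kz)[_ _ yr zr]].
    by apply: sqnorm_lerp; [exact: mul_clamp01|lra|lra].
  apply: within_addv; apply: within_scale => //.
  + by apply: within_add; [exact: within_cst|exact: within_opp].
  + by apply: cinv => [x|y z]; [exact: cvg_fst|left].
  + by apply: cinv => [x|y z]; [exact: cvg_snd|right].
- by apply: (within_compT _ (csnd _)) => x; exact: cvg_fst.
- move=> [t [y z]] [_ [/= Ky Kz]] /= xr; rewrite clamp_le0; last lra.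
  have [|yE _ _ _] := slide_inside Ky Kz; first lra.
  by rewrite mulr0 subr0 scale1r scale0r addr0.
Qed.

(** [push] fixes the points of [K'] and the centre [chi 0]. The second case arises when the attached
    cell is the vertex [y0] itself. *)
Hypothesis base : K y0 -> K' y0 \/ y0 = chi 0.

Let push_base t : 0 <= t <= 1 -> K y0 -> push (t, y0) = y0.
Proof.
move=> t1 /base[/push_K' //|->].
by rewrite push_chi ?sqnorm0 // radial_push0.
Qed.

(** The path from [y] to [z] is a chain: [y] slides to [F], which is pushed to [p]; [G] leads [p]
    and [q] to a common end; the push from [z] to [q], reversed, leads back to [z]. *)
Lemma attach_equiconnected : equiconnected R y0 K' -> equiconnected R y0 K.
Proof.
case=> w' [cw' w'1 [H [cH H0 H1 HK HB]]].
pose F x := slide (1, x); pose p x := push (1, F x).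
pose q (x : Y * Y) := push (1, x.2).
pose e x := Num.min (radius (F x)) (radius x.2).
(* [W] handles pairs away from the centre. Once [1/4 <= e x], both [p x] and [q x] lie in [K'] and
   [w'] applies; the factor is 0 at [e x = 1/4] and 1 from 1/2 on. *)
pose W x := if 1/4 <= e x then clamp (4 * (e x - 1/4)) * w' (p x, q x) else 0.
(* The second term handles pairs deep inside the cell: it is 1 up to [maxrad x = 1/2] and 0 from 3/5
   on. Together with [W] it makes [w] equal to 1 on the whole diagonal. *)
pose w x := Num.max (W x) (clamp (6 - 10 * maxrad x)).
pose D := near_diag K w; pose B := [set (y0, y0)].
have o1 : 0 <= (1 : R) <= 1 by lra.
have csnd A : {within A, continuous (@snd Y Y)}.
  by apply: continuous_subspaceT => x; exact: cvg_snd.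
have cfst A : {within A, continuous (@fst Y Y)}.
  by apply: continuous_subspaceT => x; exact: cvg_fst.
have pair1 (T : topologicalType) (A : set T) :
    {within A, continuous (fun x : T => (1 : R, x))}.
  apply: within_pair; first by move=> x; exact: cvg_cst.
  by apply: continuous_subspaceT => x; exact: cvg_id.
have cF : {within K `*` K, continuous F}.
  apply: (within_comp slide_cont) => [|x xK]; first exact: pair1.
  by rewrite cylinderE /=; split => //; lra.
have FK x : (K `*` K) x -> K (F x).
  by case: x => y z [Ky Kz]; apply: slide_K => //; lra.
have cp : {within K `*` K, continuous p}.
  apply: (within_comp push_cont) => [|x xK]; last first.
    by rewrite cylinderE /=; split; [lra|exact: FK].
  exact: (within_comp (pair1 _ setT)).
have cq : {within K `*` K, continuous q}.
  apply: (within_comp push_cont) => [|x xK]; last first.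
    by rewrite cylinderE /=; split; [lra|case: xK].
  exact: (within_comp (pair1 _ setT)).
have qK x : (K `*` K) x -> K (q x) by case=> _ ?; exact: push_K.
have ce : {within K `*` K, continuous e}.
  apply: within_min; first exact: (within_comp radius_cont).
  by apply: (within_comp radius_cont) => // x [].
have pqK' x : (K `*` K) x -> 1/4 <= e x -> K' (p x) /\ K' (q x).
  move=> xK; rewrite /e le_min => /andP[e1 e2].
  by split; apply: push1_K' => //; [exact: FK|case: xK].
have cW : {within K `*` K, continuous W}.
  apply: within_if_ge => //.
  - apply: within_mul.
      apply: within_clamp; apply: within_mul; first exact: within_cst.
      apply: within_add; last exact: within_cst.
      by apply: within_sub ce => x [].
    apply: (within_comp cw') => [|x [xK /= /(pqK' _ xK)]//].
    by apply: within_pair; [apply: within_sub cp|apply: within_sub cq] => x [].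
  - exact: within_cst.
  - by move=> x _ ->; rewrite subrr mulr0 clamp_le0 ?mul0r.
have cw : {within K `*` K, continuous w}.
  apply: within_max => //; apply: within_clamp; apply: within_add.
    exact: within_cst.
  by apply: within_opp; apply: within_mul => //; exact: within_cst.
have w1 z : K z -> w (z, z) = 1.
  move=> Kz; have Fz : F (z, z) = z by exact: slide_diag.
  rewrite /w /W /e /p /q /maxrad Fz /= minxx maxxx.
  have := clamp01 (4 * (radius z - 1/4)).
  have := clamp01 (6 - 10 * radius z).
  case: ifPn => [zr|zr c1 c2]; last first.
    by rewrite [clamp (6 - _)]clamp_ge1 ?max_r //; lra.
  rewrite w'1 ?mulr1; last exact: push1_K'.
  have [zr'|zr'] := leP (1/2) (radius z) => c1 c2.
    by rewrite [clamp (4 * _)]clamp_ge1 ?max_l //; lra.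
  by rewrite [clamp (6 - _)]clamp_ge1 ?max_r //; lra.
have DK : D `<=` K `*` K by move=> x [].
have clD : closed D.
  have -> : D = (K `*` K) `&` w @^-1` [set r | 1/2 <= r].
    by apply/seteqP; split=> x; [case|case=> -[]].
  by apply: within_closed => //; exact: closed_ge.
(* From 3/5 on only [W] can bring [w] up to 1/2; as its factor is at most 1, [w'] is then at least
   1/2. *)
have nearD x : D x -> 3/5 <= maxrad x ->
    [/\ K' (p x), K' (q x) & 1/2 <= w' (p x, q x)].
  case=> Kx1 Kx2 + xr; rewrite /w (@clamp_le0 R (6 - _)); last lra.
  rewrite le_max => /orP[|]; last lra.
  rewrite /W; case: ifPn; last lra.
  move=> /(pqK' _ (conj Kx1 Kx2))[pK' qK'] cw12; split => //.
  move: cw12; have := clamp01 (4 * (e x - 1/4)).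
  set c := clamp _ => /andP[]; rewrite le_eqVlt => /orP[/eqP <-|c0 c1 cw12].
    by rewrite mul0r; lra.
  by rewrite leNgt; apply/negP => w12; nra.
(* Up to 7/10 the slide ends at [z]. Between 3/5 and 7/10 both this and [nearD] are available. *)
have pq x : D x -> maxrad x <= 7/10 -> p x = q x.
  by case: x => y z /DK[Ky Kz] xr; rewrite /p /F slide1.
have baseD x : D x -> B x -> [/\ x = (y0, y0), K y0, p x = y0 & q x = y0].
  move=> + xE; rewrite xE => /DK[/= Ky _]; split => //.
  - by rewrite /p /F slide_diag // push_base.
  - by rewrite /q push_base.
(* [mu] rises from 0 to 1 between 3/5 and 7/10, switching on the paths of [K']. *)
pose mu x := clamp (10 * maxrad x - 6).
pose G (P : Y * Y -> Y) (s : R * (Y * Y)) :=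
  if maxrad s.2 <= 3/5 then q s.2 else H (mu s.2 * s.1, (P s.2, q s.2)).
(* To be used for both [p] and [q] as [P]: each moves towards [q] along the path in [K'], as far as
   [mu] allows. *)
have join (P : Y * Y -> Y) : {within K `*` K, continuous P} ->
    (forall x, D x -> 3/5 <= maxrad x ->
       [/\ K' (P x), K' (q x) & 1/2 <= w' (P x, q x)]) ->
    (forall x, D x -> maxrad x <= 7/10 -> P x = q x) ->
    (forall x, D x -> B x -> P x = y0) ->
    homotopic_on (R := R) D K B y0 P (fun x => G P (1, x)).
  move=> cP nearP Pq Pbase; exists (G P).
  have mu1 t x : 0 <= t <= 1 -> 0 <= mu x * t <= 1.
    by move=> t1; have := clamp01 (10 * maxrad x - 6); rewrite -/(mu x); nra.
  split.
  - have csn A : {within A, continuous (@snd R (Y * Y))}.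
      by apply: continuous_subspaceT => x; exact: cvg_snd.
    have onD (U : topologicalType) (k : Y * Y -> U) A :
        {within K `*` K, continuous k} -> A `<=` `[0, 1] `*` D ->
        {within A, continuous (fun s : R * (Y * Y) => k s.2)}.
      by move=> ck AD; apply: (within_comp ck) => // s /AD[_ /DK].
    apply: within_if_le.
    + exact: cylinder_closed.
    + exact: onD.
    + by apply: onD => // s [].
    + apply: (within_comp cH) => [|[t x] [[t1 Dx] /= xr]]; last first.
        split; first by move: t1; rewrite /= !in_itv /=; exact: mu1.
        by have [] := nearP _ Dx xr.
      apply: within_pair; last by apply: within_pair; apply: onD => // s [].
      apply: within_mul; last first.
        by apply: continuous_subspaceT => x; exact: cvg_fst.
      apply: within_clamp; apply: within_add; last exact: within_cst.
      apply: within_mul; first exact: within_cst.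
      by apply: onD => // s [].
    + move=> [t x] [_ Dx] /= xr; rewrite /mu clamp_le0 ?mul0r; last lra.
      by rewrite H0; [rewrite /= Pq //; lra|apply: nearP => //; lra].
  - move=> x Dx; rewrite /G /=; case: ifPn => xr; first by rewrite Pq //; lra.
    have xr' : 3/5 <= maxrad x by lra.
    by rewrite mulr0 H0 //; exact: nearP.
  - by [].
  - move=> t x t1 Dx; rewrite /G /=.
    case: ifPn => xr; first exact: qK (DK _ Dx).
    have xr' : 3/5 <= maxrad x by lra.
    by left; apply: HK; [exact: mu1|exact: nearP].
  - move=> t x t1 Dx Bx; rewrite /G /=; have [_ _ _ qx] := baseD _ Dx Bx.
    case: ifPn => xr //; have xr' : 3/5 <= maxrad x by lra.
    apply: HB; [exact: mu1|exact: nearP|].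
    by rewrite qx Pbase.
have pushH : homotopic_on (R := R) K K [set y0] y0 id (fun y => push (1, y)).
  exists push; split => //.
  by move=> t y t1 Ky yE; move: Ky; rewrite yE; exact: push_base.
exists w; split => //; apply: (homotopic_on_trans (g := F)) => //.
  exists slide; split => //.
  - by apply: within_sub slide_cont => -[t x] [t1 /DK].
  - by move=> [y z] /DK[Ky Kz]; exact: slide0.
  - by move=> t [y z] t1 /DK[Ky Kz]; exact: slide_K.
  - by move=> t x t1 Dx /(baseD _ Dx)[-> Ky _ _]; exact: slide_diag.
apply: (homotopic_on_trans (g := p)) => //.
  apply: (homotopic_on_comp (k := F) _ _ _ pushH).
  - by apply: within_sub cF.
  - by move=> x /DK/FK.
  - by move=> x Dx /(baseD _ Dx)[-> Ky _ _]; exact: slide_diag.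
apply: (homotopic_on_trans (g := fun x => G p (1, x))) => //.
  by apply: join => // x Dx /(baseD _ Dx)[].
apply: (homotopic_on_trans (g := q)) => //; last first.
  apply: homotopic_on_sym.
  apply: (homotopic_on_comp (k := snd) _ _ _ pushH) => //.
  - by move=> x /DK[].
  - by move=> x _ ->.
apply: homotopic_on_sym.
apply: (homotopic_on_eq (f := q) (g := fun x => G q (1, x))) => //.
  (* The common end: up to 7/10, [p x = q x]; beyond, [mu x = 1] and both paths run all the way to
     [q x]. *)
  move=> x Dx; rewrite /G /=; case: ifPn => xr //; rewrite mulr1.
  have [xr'|xr'] := leP (maxrad x) (7/10); first by rewrite pq.
  have xr2 : 3/5 <= maxrad x by lra.
  have [pK' qK' wpq] := nearD x Dx xr2.
  rewrite /mu clamp_ge1; last lra.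
  by rewrite !H1 //; split => //=; rewrite w'1 //; lra.
apply: join => // [x Dx xr|x Dx /(baseD _ Dx)[]//].
have [pK' qK' wpq] := nearD x Dx xr; split => //.
by rewrite w'1 //; lra.
Qed.

End AttachCell.

(** * Finite subcomplexes *)

(** The sets [G x] are absorbed one after another, along a list enumerating [F]. *)
Lemma finite_extend (T U : Type) (Q : set U -> Prop) (G : T -> set U)
    (F : set T) : finite_set F ->
  (forall x K, F x -> Q K -> exists K1, [/\ Q K1, K `<=` K1 & G x `<=` K1]) ->
  forall K, Q K ->
    exists K1, [/\ Q K1, K `<=` K1 & forall x, F x -> G x `<=` K1].
Proof.
move=> /(finite_seqP (T := {classic T}))[s ->].
elim: s => [|x s IHs] ext K QK; first by exists K; split.
have [K1 [QK1 K1s xK1]] := ext x K (mem_head _ _) QK.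
have [|K2 [QK2 K2s sK2]] := IHs _ K1 QK1.
  by move=> y L ys; apply: ext => /=; rewrite in_cons ys orbT.
exists K2; split => // [|y]; first exact: subset_trans K2s.
by rewrite /= in_cons => /orP[/eqP ->|/sK2//]; exact: subset_trans K2s.
Qed.

Section FiniteSubcomplexes.
Context {R : realType} {Y : topologicalType} (I : nat -> Type).
Variable chi : forall n, I n -> 'rV[R]_n -> Y.
Arguments chi : clear implicits.
Hypothesis cw : cw_structure chi.

(** Building the set in an order of attachment provides the induction on cells needed for
    equiconnectedness. *)
Inductive finite_subcomplex : set Y -> Prop :=
| finite_subcomplex0 : finite_subcomplex set0
| finite_subcomplexS (K : set Y) (n : nat) (e : I n) :
    finite_subcomplex K -> chi n e @` sphere (n := n) `<=` K ->
    open_cell chi (existT I n e) `&` K = set0 ->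
    finite_subcomplex (K `|` closed_cell chi (existT I n e)).

Let closed_cellE n (e : I n) :
  closed_cell chi (existT I n e) =
  open_cell chi (existT I n e) `|` chi n e @` sphere (n := n).
Proof.
rewrite -image_setU; congr (_ @` _); apply/seteqP; split=> v /=.
  by rewrite /disk /open_disk /sphere /= le_eqVlt => /orP[/eqP|]; [right|left].
by rewrite /disk /open_disk /sphere /= => -[/ltW|->].
Qed.

Let attachE K n (e : I n) : chi n e @` sphere (n := n) `<=` K ->
  K `|` closed_cell chi (existT I n e) = K `|` open_cell chi (existT I n e).
Proof.
move=> eK; rewrite closed_cellE; apply/seteqP; split=> y; last first.
  by case; [left|right; left].
by case=> [|[|/eK]]; [left|right|left].
Qed.

Lemma finite_subcomplex_compact K : finite_subcomplex K -> compact K.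
Proof.
elim=> [|{}K n e _ kK _ _]; first exact: compact0.
apply: compactU => //; apply: continuous_compact.
  exact: (chi_continuous cw).
exact: sqnorm_le_compact.
Qed.

(** A finite subcomplex is a union of open cells, and distinct open cells are disjoint. *)
Lemma finite_subcomplex_cell K c : finite_subcomplex K ->
  (open_cell chi c `&` K) !=set0 -> open_cell chi c `<=` K.
Proof.
elim=> [|{}K n e _ IH eK _]; first by rewrite setI0 => -[].
rewrite attachE // setIUr => -[y [cK|ce]].
  by apply: subset_trans (IH _) _; [exists y|exact: subsetUl].
have -> : c = existT I n e by apply: (open_cells_disjoint cw); exists y.
exact: subsetUr.
Qed.

Lemma finite_subcomplex_cells K : finite_subcomplex K ->
  finite_set [set c | open_cell chi c `&` K !=set0].
Proof.
elim=> [|{}K n e _ finK eK _].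
  by apply: sub_finite_set (finite_set0 _) => c [y []].
apply: (@sub_finite_set _ _ ([set c | open_cell chi c `&` K !=set0] `|`
  [set existT I n e])); last by rewrite finite_setU; split.
move=> c [y [cy]]; rewrite attachE // => -[Ky|ey]; first by left; exists y.
by right; apply: (open_cells_disjoint cw); exists y.
Qed.

(** Induction on the dimension: the boundary lies in finitely many open cells of lower dimension,
    which are absorbed first; then the cell is attached unless it is already present. *)
Lemma finite_subcomplex_extend n (e : I n) K : finite_subcomplex K ->
  exists K1, [/\ finite_subcomplex K1, K `<=` K1 &
    closed_cell chi (existT I n e) `<=` K1].
Proof.
elim/ltn_ind: n => n IH in e K *.
move=> cK; have [F [finF dimF bdF]] := closure_finite cw e.
have [|K1 [cK1 KK1 FK1]] := finite_extend (G := open_cell chi) finF _ cK.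
  move=> [k c] L /dimF /= kn /(IH k kn c)[L1 [? ? cL1]]; exists L1; split => //.
  by apply: subset_trans cL1; rewrite closed_cellE; exact: subsetUl.
have bdK1 : chi n e @` sphere (n := n) `<=` K1.
  by move=> y /bdF[c Fc]; exact: FK1.
have [eK1|eK1] := pselect (open_cell chi (existT I n e) `&` K1 !=set0).
  exists K1; split => //; rewrite closed_cellE subUset; split => //.
  exact: finite_subcomplex_cell.
exists (K1 `|` closed_cell chi (existT I n e)); split.
- apply: finite_subcomplexS => //; apply/eqP; apply: contrapT => /negP.
  by move=> /set0P.
- by apply: subset_trans KK1 _; exact: subsetUl.
- exact: subsetUr.
Qed.

Lemma finite_subcomplex_points (S K : set Y) : finite_set S ->
  finite_subcomplex K ->
  exists K1, [/\ finite_subcomplex K1, K `<=` K1 & S `<=` K1].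
Proof.
move=> finS cK.
have [|K1 [cK1 KK1 SK1]] := finite_extend (G := @set1 Y) finS _ cK.
  move=> x L _ /finite_subcomplex_extend ext.
  have [[n e] ex] := open_cells_cover cw x; have [L1 [? ? eL1]] := ext n e.
  by exists L1; split => // _ ->; apply: eL1; rewrite closed_cellE; left.
by exists K1; split => // x /SK1; exact.
Qed.

(** Each closed cell lies in a finite subcomplex, so it meets [S] in a finite set, which is closed
    since [Y] is Hausdorff. *)
Lemma closed_of_finite_traces (S : set Y) :
  (forall K, finite_subcomplex K -> finite_set (S `&` K)) -> closed S.
Proof.
move=> finS; apply: (weak_topology cw) => -[n e].
have [K1 [cK1 _ eK1]] := finite_subcomplex_extend e finite_subcomplex0.
have /accessible_finite_set_closed : accessible_space Y.
  exact: hausdorff_accessible (cw_hausdorff cw).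
by apply; apply: sub_finite_set (finS _ cK1); exact: setIS.
Qed.

(* A set meeting every cell in at most one point is closed and discrete, so a
   compact set contains only finite such sets. *)
Lemma compact_finite_subcomplex (C : set Y) : compact C ->
  exists2 K, finite_subcomplex K & C `<=` K.
Proof.
have [[z Cz]|C0 kC] := pselect (C !=set0); last first.
  exists set0; first exact: finite_subcomplex0.
  by move=> y Cy; case: C0; exists y.
move=> kC.
(* [h] picks a point of [C] in each cell that [C] meets; [z] is a default for the other cells. *)
have /choice[h hP] : forall d, exists y, C `&` open_cell chi d !=set0 ->
    (C `&` open_cell chi d) y.
  move=> d; have [[y Cy]|nC] := pselect (C `&` open_cell chi d !=set0).
    by exists y.
  by exists z.
pose S := h @` [set d | C `&` open_cell chi d !=set0].
have clS (A : set Y) : A `<=` S -> closed A.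
  move=> AS; apply: closed_of_finite_traces => K cK.
  apply: sub_finite_set (finite_image h (finite_subcomplex_cells cK)).
  move=> _ [/AS[d Cd <-] Khd]; exists d => //=; exists (h d); split => //.
  by have [] := hP d Cd.
have finS : finite_set S.
  (* [F] consists of the sets containing all but finitely many points of [S]. At a cluster point
     [p], the complement of the closed set [S] minus [p] is a neighbourhood disjoint from a member
     of [F]. *)
  apply: contrapT => infS; pose F := [set B | finite_set (S `\` B)].
  have FF : ProperFilter F.
    apply: Build_ProperFilter; first by rewrite /F /= setD0.
    split; rewrite /F /=.
    - by rewrite setDT.
    - move=> A B finA finB.
      apply: (@sub_finite_set _ _ ((S `\` A) `|` (S `\` B))); last first.
        by rewrite finite_setU; split.
      move=> y [Sy nAB]; have [Ay|nAy] := pselect (A y); last by left.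
      by right; split => // By; apply: nAB; split.
    - by move=> A B AB; apply: sub_finite_set; exact: setDS.
  have FC : F C.
    rewrite /F /= (_ : S `\` C = set0) //; apply/seteqP; split => // y.
    by case=> -[d Cd <-]; case; have [] := hP d Cd.
  have [p [_ clp]] := kC F FF FC.
  have FSp : F (S `\ p).
    apply: sub_finite_set (finite_set1 p) => y [Sy nSy].
    by apply: contrapT => yp; apply: nSy.
  have pSp : nbhs p (~` (S `\ p)).
    apply: open_nbhs_nbhs; split; last by case=> _; apply.
    by apply: closed_openC; apply: clS => y [].
  by have [q []] := clp _ _ FSp pSp.
(* A finite subcomplex through all the chosen points contains every cell that [C] meets, hence
   [C]. *)
have [K [cK _ SK]] := finite_subcomplex_points finS finite_subcomplex0.
exists K => // y Cy; have [d dy] := open_cells_cover cw y.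
have Cd : C `&` open_cell chi d !=set0 by exists y.
apply: (@finite_subcomplex_cell K d) => //; exists (h d); split.
  by have [] := hP d Cd.
by apply: SK; exists d.
Qed.

(** * Equiconnectedness of finite subcomplexes *)

Variables (y0 : Y) (v0 : I 0).
Hypothesis vertex : open_cell chi (existT I 0 v0) y0.

Lemma finite_subcomplex_equiconnected K :
  finite_subcomplex K -> equiconnected R y0 K.
Proof.
elim=> [|{}K n e cK ecK eK disj].
  (* The empty set has an empty near-diagonal, so the witnesses are arbitrary. *)
  exists (fun=> 1); split=> //; first by apply/subspace_continuousP => x [].
  exists (fun p => p.2.1); split => //; try by move=> ? ? ? [].
  - by apply/subspace_continuousP => -[t x] [_ []].
  - by move=> x [].
have eint v : sqnorm v < 1 -> ~ K (chi n e v).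
  move=> v1 Kv; have : (open_cell chi (existT I n e) `&` K) (chi n e v).
    by split => //; exists v.
  by rewrite disj.
apply: (attach_equiconnected _ _ _ _ _ _ _ ecK).
- exact: cw_hausdorff cw.
- exact: finite_subcomplex_compact.
- exact: (chi_continuous cw).
- exact: (chi_injective cw).
- by move=> v v1; apply: eK; exists v.
- exact: eint.
(* If [y0] lies in the open cell, that cell is the vertex [v0], so [n = 0] and [y0] is the image of
   0, the only vector. Otherwise [y0] is already in [K]. *)
- case=> [|[v v1 vy]]; first by left.
  move: v1; rewrite /disk /= le_eqVlt => /orP[/eqP v1|v1].
    by left; rewrite -vy; apply: eK; exists v.
  right; have /(congr1 (@projT1 _ _)) /= n0 : existT I n e = existT I 0 v0.
    by apply: (open_cells_disjoint cw); exists y0; split => //; exists v.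
  have rV0 m (w : 'rV[R]_m) : m = 0%N -> w = 0.
    by move=> m0; move: w; rewrite m0 => w; rewrite thinmx0.
  by rewrite -vy (rV0 _ v n0).
Qed.

End FiniteSubcomplexes.

(** * Transporting ensembles along a homotopy *)

Section Ends.
Context {R : realType} {Z Y : topologicalType}.
Variables (D B : set Z) (K : set Y) (y0 : Y) (f g : Z -> Y).
Hypothesis fg : homotopic_on (R := R) D K B y0 f g.

(** Supplies the continuity of a map obtained as the end of a homotopy, such as [follow x (c x)] in
    [x]. *)
Lemma homotopic_on_end_continuous : {within D, continuous g}.
Proof.
have [H [cH _ H1 _ _]] := fg.
apply: (within_ext (f := fun z => H (1, z))); first exact: H1.
apply: (within_comp cH) => [|z Dz]; last first.
  by rewrite cylinderE /=; split=> //; lra.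
apply: within_pair; first by move=> x; exact: cvg_cst.
by apply: continuous_subspaceT => x; exact: cvg_id.
Qed.

Lemma homotopic_on_end_base z : D z -> B z -> g z = y0.
Proof.
by move=> Dz Bz; have [H [_ _ H1 _ HB]] := fg; rewrite -H1 // HB //; lra.
Qed.

End Ends.

Lemma homotopicP (R : realType) (X Y : topologicalType) (x0 : X) (y0 : Y)
    (f g : based_map x0 y0) :
  homotopic R f g <-> homotopic_on (R := R) setT setT [set x0] y0 f g.
Proof.
split=> [[H [cH H0 H1 HB]]|[H [cH H0 H1 _ HB]]]; exists H; split => //.
- by move=> t z t1 _ ->; exact: HB.
- by move=> x; exact: H0.
- by move=> x; exact: H1.
- by move=> t t1; exact: HB.
Qed.

Lemma based_map_ext (X Y : topologicalType) (x0 : X) (y0 : Y)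
    (f g : based_map x0 y0) : (forall x, f x = g x) -> f = g.
Proof.
case: f g => [f cf f0] [g cg g0] /= /funext fg; subst g.
by congr BasedMap; exact: Prop_irrelevance.
Qed.

(** * Carrying a single map along the homotopy from b to tb *)

Section Follow.
Context {R : realType} {X Y : topologicalType} (x0 : X) (y0 : Y).
Variables (K : set Y) (w : Y * Y -> R) (H : R * (Y * Y) -> Y).
Variables (b tb : based_map x0 y0) (h : R * X -> Y).
Hypothesis cw : {within K `*` K, continuous w}.
Hypothesis w1 : forall z, K z -> w (z, z) = 1.
Hypothesis cH : {within `[0, 1] `*` near_diag K w, continuous H}.
Hypothesis H0 : forall x, near_diag K w x -> H (0, x) = x.1.
Hypothesis H1 : forall x, near_diag K w x -> H (1, x) = x.2.
Hypothesis Hbase : forall t, 0 <= t <= 1 -> H (t, (y0, y0)) = y0.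
Hypothesis ch : {within `[0, 1] `*` setT, continuous h}.
Hypothesis h0 : forall x, h (0, x) = b x.
Hypothesis h1 : forall x, h (1, x) = tb x.
Hypothesis hbase : forall t, 0 <= t <= 1 -> h (t, x0) = y0.
Hypothesis bK : forall x, K (b x).

(** As [w (y, b x)] grows from 1/2 to 3/4, the value moves from [y] to [b x] along [H]; from 3/4 to
    1 it goes on along [h] to [tb x]. *)
Definition follow (x : X) (y : Y) : Y :=
  let r := w (y, b x) in
  if 3/4 <= r then h (clamp (4 * r - 3), x)
  else if 1/2 <= r then H (clamp (4 * r - 2), (y, b x)) else y.

Lemma follow_start x : follow x (b x) = tb x.
Proof. by rewrite /follow w1 // ifT ?clamp_ge1 ?h1 //; lra. Qed.

(** The two phases of [follow] are performed in succession, each by multiplying its clamped time by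
    the homotopy parameter. *)
Lemma follow_homotopic (c : based_map x0 y0) : (forall x, K (c x)) ->
  exists2 c' : based_map x0 y0, homotopic R c c' &
    forall x, c' x = follow x (c x).
Proof.
move=> cK; pose om x := w (c x, b x).
have cont_based (f : based_map x0 y0) A : {within A, continuous f}.
  by apply: continuous_subspaceT; exact: map_continuous.
have com A : {within A, continuous om}.
  apply: (within_comp cw) => [|x _]; last by split; [exact: cK|exact: bK].
  exact: (within_pair (cont_based c A) (cont_based b A)).
have om0 : om x0 = 1 by rewrite /om !map_base w1 // -(map_base b).
have csnd A : {within A, continuous (@snd R X)}.
  by apply: continuous_subspaceT => x; exact: cvg_snd.
have cfst A : {within A, continuous (@fst R X)}.
  by apply: continuous_subspaceT => x; exact: cvg_fst.
have comsnd A : {within A, continuous (fun p : R * X => om p.2)}.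
  by apply: (within_comp (com setT)).
have clcyl : closed (`[0, 1] `*` setT : set (R * X)).
  exact: cylinder_closed closedT.
have coef A (k : R) :
    {within A, continuous (fun p : R * X => p.1 * clamp (4 * om p.2 - k))}.
  apply: within_mul => //; apply: within_clamp.
  apply: within_add; last exact: within_cst.
  by apply: within_mul => //; exact: within_cst.
have near x : 1/2 <= om x -> near_diag K w (c x, b x).
  by move=> xr; split; [exact: cK|exact: bK|].
(* [E] is the outcome of the first phase; it equals [b x], where [h] starts, wherever
   [3/4 <= om x]. *)
pose E x := if 1/2 <= om x then H (clamp (4 * om x - 2), (c x, b x)) else c x.
have cE : homotopic_on (R := R) setT setT [set x0] y0 c E.
  exists (fun p => if 1/2 <= om p.2 then
    H (p.1 * clamp (4 * om p.2 - 2), (c p.2, b p.2)) else c p.2); split => //.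
  - apply: within_if_ge => //.
    + apply: (within_comp cH) => [|[t x] [[t1 _] /= /near xD]]; last first.
        by split => //; move: t1; rewrite /= !in_itv; exact: mul_clamp01.
      by apply: within_pair => //; apply: within_pair;
        apply: (within_comp (cont_based _ setT)).
    + exact: (within_comp (cont_based c setT)).
    + move=> [t x] _ /= xr; rewrite clamp_le0; last lra.
      by rewrite mulr0 H0 //; apply: near; lra.
  - by move=> x _ /=; case: ifP => // /near xD; rewrite mul0r H0.
  - by move=> x _ /=; rewrite [1 * clamp _]mul1r.
  - move=> t x t1 _ -> /=; rewrite om0 !map_base; case: ifP => // _.
    by apply: Hbase; exact: mul_clamp01.
have Ec : homotopic_on (R := R) setT setT [set x0] y0 E
    (fun x => follow x (c x)).
  exists (fun p => if 3/4 <= om p.2 then h (p.1 * clamp (4 * om p.2 - 3), p.2)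
    else E p.2); split => //.
  - apply: within_if_ge => //.
    + apply: (within_comp ch) => [|[t x] [[t1 _] _]]; last first.
        by split => //; move: t1; rewrite /= !in_itv; exact: mul_clamp01.
      exact: within_pair.
    + by apply: (within_comp (homotopic_on_end_continuous cE)).
    + move=> [t x] _ /= xr; rewrite clamp_le0; last lra.
      rewrite mulr0 h0 /E ifT ?clamp_ge1 ?H1 //; try lra.
      by apply: near; lra.
  - move=> x _ /=; case: ifP => // xr; rewrite mul0r h0 /E ifT; last lra.
    by rewrite clamp_ge1 ?H1 //; [apply: near|]; lra.
  - by move=> x _ /=; rewrite [1 * clamp _]mul1r.
  - move=> t x t1 _ -> /=; rewrite om0 ifT; last lra.
    by apply: hbase; exact: mul_clamp01.
have cc := homotopic_on_trans closedT cE Ec.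
have cont : continuous (fun x => follow x (c x)).
  by apply/continuous_subspace_setT; exact: homotopic_on_end_continuous cc.

have fbase : follow x0 (c x0) = y0 by exact: (homotopic_on_end_base cc I).
by exists (BasedMap cont fbase) => //; apply/homotopicP.
Qed.

End Follow.

Lemma scale_freegU (K : choiceType) (k : int) (x : K) :
  k *: (<< x >> : {freeg K / int}) = << k *g x >>.
Proof. by apply/eqP/freeg_eqP => y; rewrite coeffZ !coeffU mul1r. Qed.

HB.instance Definition _ (K : choiceType) (M : lmodType int) (f : K -> M) :=
  GRing.isAdditive.Build {freeg K / int} M (fglift f) (lift_is_additive f).

(** * The induced action on ensembles and their restrictions *)

Section Transport.
Variables (X Y : topologicalType) (x0 : X) (y0 : Y) (r n : nat).
Variables (u : 'I_n -> int) (Phi : X -> Y -> Y).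

Lemma ens_restr_sum T (Tx0 : T x0) (c : 'I_n -> based_map x0 y0) :
  ens_restr Tx0 (\sum_(i < n) << u i *g c i >>) =
  \sum_(i < n) << u i *g map_restr Tx0 (c i) >>.
Proof.
rewrite /ens_restr raddf_sum; apply: eq_bigr => i _.
by rewrite /= liftU scale_freegU.
Qed.

(* Phi acts on the restrictions to T of maps, hence on their ensembles. *)
Lemma req_transport (c c' : 'I_n -> based_map x0 y0) (b b' : based_map x0 y0) :
  (forall i x, c' i x = Phi x (c i x)) -> (forall x, b' x = Phi x (b x)) ->
  req r (\sum_(i < n) << u i *g c i >>) << b >> ->
  req r (\sum_(i < n) << u i *g c' i >>) << b' >>.
Proof.
move=> cc' bb' cb T hT; have := cb T hT; set Tx0 := proj1 hT.
(* Applying [Phi] pointwise to [f] need not give a based map; then [theta f] defaults to [f]. On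
   restrictions of the maps at hand the result is a based map, and its uniqueness identifies
   [theta f]. *)
have /choice[theta thetaP] : forall f : based_map (sub_base Tx0) y0,
    exists g : based_map (sub_base Tx0) y0,
    forall g' : based_map (sub_base Tx0) y0,
      (forall x, g' x = Phi (set_val x) (f x)) -> g = g'.
  move=> f; have [[g gP]|nf] := pselect (exists g : based_map (sub_base Tx0) y0,
      forall x, g x = Phi (set_val x) (f x)).
    by exists g => g' g'P; apply: based_map_ext => x; rewrite gP g'P.
  by exists f => g' g'P; case: nf; exists g'.
have thetaE (f f' : based_map x0 y0) : (forall x, f' x = Phi x (f x)) ->
    theta (map_restr Tx0 f) = map_restr Tx0 f'.
  by move=> ff'; apply: thetaP => x /=.
rewrite !ens_restr_sum /ens_restr !liftU !scale1r.
(* The additive extension of [theta] carries the equation over [T] for [b] to the one for [b']. *)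
move=> /(congr1 (fglift (fun f => << theta f >>))).
rewrite raddf_sum !liftU scale1r (thetaE _ _ bb') => <-; apply: eq_bigr => i _.
by rewrite /= liftU (thetaE _ _ (cc' i)) scale_freegU.
Qed.

End Transport.

Theorem theorem5p2 (R : realType) (X Y : topologicalType) (x0 : X) (y0 : Y)
    (r : nat) (a b ta tb : based_map x0 y0) :
  cellular R x0 -> cellular R y0 -> compact [set: X]%classic ->
  homotopic R ta a -> rsimilar R r a b -> homotopic R b tb ->
  rsimilar R r ta tb.
Proof.
move=> _ [I [chi [cw [v0 vertex]]]] kX taa [n [u [c [ca cb]]]].
case=> h [ch h0 h1 hbase].
have compact_range (f : based_map x0 y0) : compact (f @` setT).
  apply: continuous_compact => //; apply: continuous_subspaceT.
  exact: map_continuous.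
(* Covering the values of [b] and of all [c i] makes [w] available at every pair [(c i x, b x)]. *)
pose C := (b @` setT) `|` \big[setU/set0]_(i < n) (c i @` setT).
have kC : compact C by apply: compactU => //; exact: bigsetU_compact.
have [K cK CK] := compact_finite_subcomplex cw kC.
have bK x : K (b x) by apply: CK; left; exists x.
have ciK i x : K (c i x).
  by apply: CK; right; rewrite (bigD1 i) //=; left; exists x.
have [w [cw' w1 [H [cH H0 H1 _ HB]]]] :=
  finite_subcomplex_equiconnected cw vertex cK.
have Ky0 : K y0 by rewrite -(map_base b).
have Hbase t : 0 <= t <= 1 -> H (t, (y0, y0)) = y0.
  by move=> t1; apply: HB => //; split => //=; rewrite w1 //; lra.
have /choice[c' c'P] : forall i, exists c' : based_map x0 y0,
    homotopic R (c i) c' /\ forall x, c' x = follow w H b h x (c i x).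
  move=> i; have [c' cc' c'E] := follow_homotopic cw' w1 cH H0 H1 Hbase ch h0
    hbase bK (ciK i).
  by exists c'.
(* The coefficients are kept; [c' i] is homotopic to [c i], hence to [a] and to [ta]. *)
exists n, u, c'; split=> [i|].
  have /homotopicP cc' := (c'P i).1.
  apply/homotopicP; apply: (homotopic_on_trans closedT (homotopic_on_sym cc')).
  apply: (homotopic_on_trans closedT (g := a)); first exact/homotopicP.
  by apply: homotopic_on_sym; exact/homotopicP.
apply: (req_transport (Phi := follow w H b h)) cb => [i x|x].
  exact: (c'P i).2.
by rewrite (follow_start _ w1 h1 bK).
Qed.
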